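(* For every integer $k\ge 0$, $$A_k(q) = \frac{(-1)^k}{(2k+1)!\,(q;q)_\infty^3}\sum_{n=0}^\infty (-1)^n(2n+1)\frac{(n+k)!}{(n-k)!}\,q^{\frac{1}{2}n(n+1)},$$ and for every integer $k\ge 1$, $$C_k(q) = \frac{(-1)^k\,(-q;q)_\infty}{(2k)!\,(q;q)_\infty}\sum_{n=1}^\infty (-1)^n\, 2n\, \frac{(n+k-1)!}{(n-k)!}\,q^{n^2},$$ as formal power series in $q$, where $\frac{1}{(n-k)!}$ is interpreted as $0$ when $n<k$.
   Context: Notation: $(a;q)_\infty = \prod_{j=0}^\infty (1 - aq^j)$; thus $(q;q)_\infty=\prod_{j\ge1}(1-q^j)$ and $(-q;q)_\infty=\prod_{j\ge1}(1+q^j)$. MacMahon's generalized sum-of-divisors generating functions are, for integers $k\ge 1$ (sums over integers $m_1,\dots,m_k$), $$A_k(q) = \sum_{0<m_1 < \cdots < m_k}\frac{q^{m_1 + \cdots + m_k}}{(1 - q^{m_1})^2 \cdots (1 - q^{m_k})^2},$$ $$C_k(q) = \sum_{0<m_1 < \cdots < m_k}\frac{q^{2m_1 + \cdots +2m_k - k}}{(1 - q^{2m_1 - 1})^2 \cdots (1 - q^{2m_k - 1})^2},$$ with the convention $A_0(q)=C_0(q)=1$. *)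

(* Defs.v *)
From HB Require Import structures.
From mathcomp Require Import all_boot all_order all_algebra.
From mathcomp Require Import all_classical.

Set Implicit Arguments.
Unset Strict Implicit.
Unset Printing Implicit Defensive.

Import Order.TTheory GRing.Theory Num.Theory.
Local Open Scope classical_set_scope.
Local Open Scope ring_scope.

(* Formal power series in one variable: [f n] is the coefficient of q^n. A
   record rather than an alias of [nat -> R], because function types already
   carry the pointwise ring structure. *)
Record fps (R : Type) := FPS { fps_coef :> nat -> R }.

Lemma fpsP (R : Type) (f g : fps R) : f =1 g <-> f = g.
Proof.
split=> [|-> //]; case: f g => [f] [g] /= efg.
by congr FPS; apply: funext.
Qed.

HB.instance Definition _ (R : Type) := gen_eqMixin (fps R).
HB.instance Definition _ (R : Type) := gen_choiceMixin (fps R).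

Section FpsZmodule.
Variable R : nzRingType.
Implicit Types f g : fps R.

Definition fps_zero : fps R := FPS (fun=> 0).
Definition fps_opp f : fps R := FPS (fun n => - f n).
Definition fps_add f g : fps R := FPS (fun n => f n + g n).

Fact fps_addA : associative fps_add.
Proof. by move=> f g h; apply/fpsP => n /=; rewrite addrA. Qed.
Fact fps_addC : commutative fps_add.
Proof. by move=> f g; apply/fpsP => n /=; rewrite addrC. Qed.
Fact fps_add0 : left_id fps_zero fps_add.
Proof. by move=> f; apply/fpsP => n /=; rewrite add0r. Qed.
Fact fps_addN : left_inverse fps_zero fps_opp fps_add.
Proof. by move=> f; apply/fpsP => n /=; rewrite addNr. Qed.

HB.instance Definition _ := GRing.isZmodule.Build (fps R)
  fps_addA fps_addC fps_add0 fps_addN.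

End FpsZmodule.

Section FpsRing.
Variable R : comUnitRingType.
Implicit Types f g h : fps R.

Definition fps_one : fps R := FPS (fun n => (n == 0)%:R).
Definition fps_mul f g : fps R :=
  FPS (fun n => \sum_(j < n.+1) f j * g (n - j)%N).

Definition fps_trunc (N : nat) f : {poly R} := \poly_(i < N.+1) f i.

Lemma coef_fps_trunc N f n : (n <= N)%N -> (fps_trunc N f)`_n = f n.
Proof. by move=> nN; rewrite coef_poly ltnS nN. Qed.

Lemma fps_mul_trunc N f g n : (n <= N)%N ->
  fps_mul f g n = (fps_trunc N f * fps_trunc N g)`_n.
Proof.
move=> nN; rewrite coefM; apply: eq_bigr => j _.
rewrite !coef_fps_trunc //; first exact: leq_trans (leq_subr _ _) nN.
by apply: leq_trans nN; rewrite -ltnS.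
Qed.

Fact fps_mulC : commutative fps_mul.
Proof.
by move=> f g; apply/fpsP => n; rewrite !(@fps_mul_trunc n) // mulrC.
Qed.

Fact fps_mulA : associative fps_mul.
Proof.
move=> f g h; apply/fpsP => n.
transitivity (fps_trunc n f * (fps_trunc n g * fps_trunc n h))`_n.
  rewrite coefM; apply: eq_bigr => j _.
  rewrite coef_fps_trunc; last by rewrite -ltnS.
  by rewrite (@fps_mul_trunc n) // leq_subr.
rewrite mulrA coefM; apply: eq_bigr => j _.
have jn : (j <= n)%N by rewrite -ltnS.
by rewrite coef_fps_trunc ?leq_subr // (@fps_mul_trunc n _ _ j).
Qed.

Fact fps_mul1 : left_id fps_one fps_mul.
Proof.
move=> f; apply/fpsP => n; rewrite /= big_ord_recl /= mul1r subn0.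
by rewrite big1 ?addr0 // => j _; rewrite mul0r.
Qed.

Fact fps_mulDl : left_distributive fps_mul +%R.
Proof.
move=> f g h; apply/fpsP => n /=; rewrite -big_split /=.
by apply: eq_bigr => j _; rewrite mulrDl.
Qed.

Fact fps_one_neq0 : fps_one != 0.
Proof.
apply/eqP => /fpsP /(_ 0) /= /eqP.
by rewrite oner_eq0.
Qed.

HB.instance Definition _ := GRing.Zmodule_isComNzRing.Build (fps R)
  fps_mulA fps_mulC fps_mul1 fps_mulDl fps_one_neq0.

(* A series is a unit iff its constant coefficient is; the coefficients g n of
   its inverse are then obtained recursively from
   f 0 * g n = (n == 0) - \sum_(j < n) f (n - j) * g j. *)
Definition fps_unit : pred (fps R) := fun f => f 0 \is a GRing.unit.

Fixpoint fps_inv_seq f (n : nat) : seq R :=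
  if n is n'.+1 then
    let s := fps_inv_seq f n' in
    rcons s ((f 0)^-1 * ((n' == 0)%:R - \sum_(j < n') f (n' - j)%N * s`_j))
  else [::].

Definition fps_inv f : fps R :=
  if f \in fps_unit then FPS (fun n => (fps_inv_seq f n.+1)`_n) else f.

Lemma size_fps_inv_seq f n : size (fps_inv_seq f n) = n.
Proof. by elim: n => //= n IHn; rewrite size_rcons IHn. Qed.

Lemma nth_fps_inv_seq f n j : (j < n)%N ->
  (fps_inv_seq f n)`_j = (fps_inv_seq f j.+1)`_j.
Proof.
elim: n => // n IHn; rewrite ltnS leq_eqVlt => /predU1P[-> //|jn].
by rewrite [LHS]/= nth_rcons size_fps_inv_seq jn IHn.
Qed.

Fact fps_mulVr : {in fps_unit, left_inverse 1 fps_inv *%R}.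
Proof.
move=> f fU; rewrite mulrC /fps_inv fU; apply/fpsP => n.
rewrite [LHS]/= big_ord_recl /= subn0.
rewrite nth_rcons size_fps_inv_seq ltnn eqxx mulrA mulrV // mul1r.
apply/eqP; rewrite addrAC subr_eq; apply/eqP; congr (_ + _).
rewrite (reindex_inj rev_ord_inj) /=.
apply: eq_bigr => j _; rewrite /bump leq0n add1n.
have jn := ltn_ord j; rewrite subnSK // subKn ?(ltnW jn) //.
by rewrite [in RHS]nth_fps_inv_seq.
Qed.

Fact fps_unitP f g : g * f = 1 -> f \in fps_unit.
Proof.
move=> /fpsP /(_ 0); rewrite /= big_ord_recl big_ord0 addr0 /= => gf.
by apply/unitrPr; exists (g 0); rewrite mulrC.
Qed.

Fact fps_inv_out : {in [predC fps_unit], fps_inv =1 id}.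
Proof. by move=> f; rewrite inE /= /fps_inv => /negbTE ->. Qed.

HB.instance Definition _ := GRing.ComNzRing_hasMulInverse.Build (fps R)
  fps_mulVr fps_unitP fps_inv_out.

(* The variable q. *)
Definition fpsX : fps R := FPS (fun n => (n == 1)%:R).

(* Limit for the coefficientwise (discrete) topology: the N-th coefficient is
   the eventual value of the N-th coefficients, and 0 if they do not become
   constant. *)
Definition fps_lim (u : nat -> fps R) : fps R :=
  FPS (fun N => xget 0 [set c | \forall n \near \oo, u n N = c]).

(* Sum of a family of power series, coefficient by coefficient; it is
   meaningful for summable families, those for which every coefficient is
   nonzero in only finitely many terms. *)
Definition fps_sum (I : choiceType) (D : set I) (F : I -> fps R) : fps R :=
  FPS (fun N => \sum_(i \in D) F i N).

Definition fps_summable (I : choiceType) (D : set I) (F : I -> fps R) : Prop :=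
  forall N, finite_set (D `&` [set i | F i N != 0]).

Definition qPochhammer_inf (a q : fps R) : fps R :=
  fps_lim (fun n => \prod_(j < n) (1 - a * q ^+ j)).

End FpsRing.

Arguments fpsX {R}.

Section FpsConvergence.
Variable R : comUnitRingType.
Implicit Types f g : fps R.

Lemma fps_limP (u : nat -> fps R) f :
  (forall N, \forall n \near \oo, u n N = f N) -> fps_lim u = f.
Proof.
move=> uf; apply/fpsP => N /=; apply: xget_unique; first exact: uf.
move=> c uc.
by have [n [<- <-]] := filter_ex (filterI uc (uf N)).
Qed.

Lemma fps_coefXnM f n N :
  (fpsX ^+ n * f) N = if (N < n)%N then 0 else f (N - n)%N.
Proof.
elim: n N f => [|n IHn] N f; first by rewrite expr0 mul1r subn0.
rewrite exprSr -mulrA IHn.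
have XM M : (fpsX * f) M = if M is M'.+1 then f M' else 0.
  case: M => [|M]; first by rewrite /= big_ord_recl big_ord0 /= mul0r addr0.
  rewrite /= big_ord_recl big_ord_recl /= mul0r add0r mul1r subSS subn0.
  by rewrite big1 ?addr0 // => j _; rewrite mul0r.
rewrite ltnS XM; case: (ltngtP N n) => [//|nN|->]; last by rewrite subnn.
by rewrite -subnSK.
Qed.

Lemma qPochhammer_inf_cvg (a : fps R) N :
  \forall n \near \oo,
    (\prod_(j < n) (1 - a * fpsX ^+ j)) N = qPochhammer_inf a fpsX N.
Proof.
pose u n : fps R := \prod_(j < n) (1 - a * fpsX ^+ j).
have uS n M : (M < n)%N -> u n.+1 M = u n M.
  move=> Mn; have -> : u n.+1 = u n - fpsX ^+ n * (u n * a).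
    by rewrite [in LHS]/u big_ord_recr /= mulrBr mulr1 [in RHS]mulrC mulrA.
  transitivity (u n M - (fpsX ^+ n * (u n * a)) M) => //.
  by rewrite fps_coefXnM Mn subr0.
pose l := FPS (fun M => u M.+1 M).
have ul M n : (M < n)%N -> u n M = l M.
  elim: n => // n IHn; rewrite ltnS leq_eqVlt => /predU1P[->//|Mn].
  by rewrite uS ?IHn.
have -> : qPochhammer_inf a fpsX = l.
  by apply: fps_limP => M; exists M.+1 => // n /= /ul.
by exists N.+1 => // n /= /ul.
Qed.

End FpsConvergence.

(* The index set 0 < m_1 < ... < m_k; for k = 0 it consists of the empty tuple,
   so that both generating functions are 1 (macmahonA0, macmahonC0 below). *)
Definition increasing_pos (k : nat) : set (k.-tuple nat) :=
  [set m | path ltn 0%N m].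
Arguments increasing_pos k : clear implicits.

Definition macmahonA_term (R : comUnitRingType) k (m : k.-tuple nat) :
    fps R :=
  fpsX ^+ (\sum_(i < k) tnth m i)
    / \prod_(i < k) (1 - fpsX ^+ tnth m i) ^+ 2.

Definition macmahonA (R : comUnitRingType) (k : nat) : fps R :=
  fps_sum (increasing_pos k) (@macmahonA_term R k).

(* The truncated subtractions are exact, since every m_i is positive on
   [increasing_pos k]. *)
Definition macmahonC_term (R : comUnitRingType) k (m : k.-tuple nat) :
    fps R :=
  fpsX ^+ ((\sum_(i < k) 2 * tnth m i) - k)
    / \prod_(i < k) (1 - fpsX ^+ (2 * tnth m i - 1)) ^+ 2.

Definition macmahonC (R : comUnitRingType) (k : nat) : fps R :=
  fps_sum (increasing_pos k) (@macmahonC_term R k).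

(* 1 / (n - k)!, read as 0 when n < k. *)
Definition inv_fact_sub (R : unitRingType) (n k : nat) : R :=
  if (n < k)%N then 0 else ((n - k)`!%:R)^-1.

Section MacMahonWellDefined.
Variable R : comUnitRingType.

Lemma macmahonA0 : macmahonA R 0 = 1.
Proof.
apply/fpsP => N; rewrite /macmahonA /fps_sum [LHS]/=.
have -> : increasing_pos 0 = [set [tuple] : 0.-tuple nat].
  by apply/seteqP; split=> m _; rewrite ?[m]tuple0.
have E : macmahonA_term R ([tuple] : 0.-tuple nat) = 1.
  by rewrite /macmahonA_term !big_ord0 expr0 mul1r invr1.
by rewrite fsbig_set1; exact: (congr1 (fun f : fps R => f N) E).
Qed.

Lemma macmahonC0 : macmahonC R 0 = 1.
Proof.
apply/fpsP => N; rewrite /macmahonC /fps_sum [LHS]/=.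
have -> : increasing_pos 0 = [set [tuple] : 0.-tuple nat].
  by apply/seteqP; split=> m _; rewrite ?[m]tuple0.
have E : macmahonC_term R ([tuple] : 0.-tuple nat) = 1.
  by rewrite /macmahonC_term !big_ord0 expr0 mul1r invr1.
by rewrite fsbig_set1; exact: (congr1 (fun f : fps R => f N) E).
Qed.

Lemma increasing_pos_gt0 k (m : k.-tuple nat) (i : 'I_k) :
  increasing_pos k m -> (0 < tnth m i)%N.
Proof.
rewrite /increasing_pos /= (path_sortedE ltn_trans) => /andP[/allP m0 _].
exact/m0/mem_tnth.
Qed.

Lemma fps_summable_tuple k (D : set (k.-tuple nat)) (e : k.-tuple nat -> nat)
    (F : k.-tuple nat -> fps R) :
  (forall m i, D m -> (tnth m i <= e m)%N) ->
  fps_summable D (fun m => fpsX ^+ e m * F m).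
Proof.
move=> De N.
pose h (t : k.-tuple 'I_N.+1) : k.-tuple nat := [tuple of map val t].
apply: (@sub_finite_set _ _ (h @` [set: k.-tuple 'I_N.+1])); last first.
  exact: finite_image (@finite_finset _ _).
move=> m [Dm]; rewrite /mkset fps_coefXnM; case: ltnP; first by rewrite eqxx.
move=> emN _; exists [tuple inord (tnth m i) | i < k] => //.
apply: eq_from_tnth => i; rewrite tnth_map tnth_mktuple /= inordK // ltnS.
exact: leq_trans (De _ i Dm) emN.
Qed.

Lemma macmahonA_summable k :
  fps_summable (increasing_pos k) (@macmahonA_term R k).
Proof.
apply: fps_summable_tuple => m i _.
by rewrite (bigD1 i) //= leq_addr.
Qed.

Lemma macmahonC_summable k :
  fps_summable (increasing_pos k) (@macmahonC_term R k).
Proof.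
apply: fps_summable_tuple => m i Dm.
have -> : (\sum_(i < k) 2 * tnth m i - k = \sum_(i < k) (2 * tnth m i - 1))%N.
  have kE : (\sum_(j < k) 1 = k)%N by rewrite sum1_card card_ord.
  rewrite -[X in (_ - X)%N = _]kE -sumnB // => j _; rewrite muln_gt0.
  exact: increasing_pos_gt0.
rewrite (bigD1 i) //=; apply: leq_trans (leq_addr _ _).
have := increasing_pos_gt0 i Dm; case: (tnth m i) => // p _.
by rewrite mul2n doubleS subn1 /= ltnS -addnn leq_addr.
Qed.

(* Used with e n = n(n+1)/2 and e n = n^2. *)
Lemma fps_summable_nat (D : set nat) (e : nat -> nat) (F : nat -> fps R) :
  (forall n, (n <= e n)%N) -> fps_summable D (fun n => F n * fpsX ^+ e n).
Proof.
move=> ne N; apply: (@sub_finite_set _ _ `I_N.+1); last exact: finite_II.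
move=> n [_]; rewrite /mkset mulrC fps_coefXnM; case: ltnP => [|enN _].
  by rewrite eqxx.
by rewrite ltnS (leq_trans (ne n)).
Qed.

End MacMahonWellDefined.

(* Main.v *)
Require Import Defs.
From mathcomp Require Import all_boot all_order all_algebra.
From mathcomp Require Import all_classical.
From mathcomp Require Import ring zify.

(** The elementary symmetric functions of the series q^m / (1 - q^m)^2 are
    generated by a product which is one side of the Jacobi triple product in
    disguise.  Put w = z + 1/z - 2.  Then
      (1 - z a) (1 - a / z) = (1 - a)^2 - a w
                            = (1 - a)^2 (1 - w a / (1 - a)^2),
    so that the coefficient of w^k in the product of these factors over
    a = q, q^2, q^3, ... is (-1)^k A_k (q;q)^2, and over a = q, q^3, q^5, ...
    it is (-1)^k C_k (q;q^2)^2.  The triple product turns both into a sum of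
    (-1)^n q^(n(n+1)/2) (z^-n + ... + z^n), respectively
    (-1)^n q^(n^2) (z^n + z^-n), and it remains to expand these symmetric
    Laurent polynomials in powers of w, which produces the binomial
    coefficients of the statement.

    To stay within finite algebra, the triple product is used in its finite
    form, valid in every commutative ring ([finite_jtp]): the product of the
    first N factors is a sum with q-binomial coefficients, which is proved by
    induction on N.  Laurent polynomials in z are avoided by working with
    polynomials in w ([theta_poly]): all that the induction needs is the
    relation (z + 1/z) B_n = B_(n+1) + B_(n-1) with the right boundary values
    ([three_term]).  One boolean s treats both cases: s = true is the family
    A and s = false the family C.

    Taking the coefficient of w^k gives an identity between power series in q
    for each N ([finite_macmahon]).  Modulo q^(M+1) and for N = 2 M every
    finite product in it agrees with its limit, and so does the symmetric
    function of N arguments with the MacMahon series ([macmahonA_elem_sym],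
    [macmahonC_elem_sym]); letting M vary gives [macmahon_theta].  For C the
    products that occur are rewritten with Euler's identity
    (q;q^2) (-q;q) = 1. *)

Set Implicit Arguments.
Unset Strict Implicit.
Unset Printing Implicit Defensive.

Import GRing.Theory.
Local Open Scope classical_set_scope.
Local Open Scope ring_scope.

(** * The finite Jacobi triple product *)

(** The base p of the q-binomial coefficients, such that r, r p, r p^2, ... is
    r, r^2, r^3, ... for s = true and r, r^3, r^5, ... for s = false. *)
Definition theta_base (L : comNzRingType) (s : bool) (r : L) : L :=
  if s then r else r ^+ 2.

Definition qfact (L : comNzRingType) (p : L) (m : nat) : L :=
  \prod_(j < m) (1 - p ^+ j.+1).

(** With r = q this is q^(n(n+1)/2) for s = true and q^(n^2) for s = false; the
    common shape p^(n(n-1)/2) r^n makes one induction serve both cases. *)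
Definition theta_coef (L : comNzRingType) (s : bool) (r : L) (n : nat) : L :=
  theta_base s r ^+ 'C(n, 2) * r ^+ n.

Definition theta_step (L : comNzRingType) (s : bool) (r : L) (i : nat) : L :=
  theta_base s r ^+ i * r.

(** Extended by 0 to n > m, as 1 / (p;p)_m is for negative m when [u] is the
    sequence of inverses of [qfact p]; this makes [inv_subS] hold for all
    indices. *)
Definition inv_sub (L : comNzRingType) (u : nat -> L) (m n : nat) : L :=
  if (n <= m)%N then u (m - n)%N else 0.

(** When [u] inverts [qfact p], this times (p;p)_(2N+s) is the coefficient of
    B_n in the product of N factors: a sign, powers of p and r, and the
    p-binomial coefficient of 2N+s over N-n. *)
Definition jtp_coef (L : comNzRingType) (s : bool) (r : L) (u : nat -> L)
    (N n : nat) : L :=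
  (-1) ^+ n * theta_coef s r n * inv_sub u N n * u (N + n + s)%N.

(** The relations of B_n = z^-n + ... + z^n (s = true) and of B_n = z^n + z^-n
    (s = false) with t = z + 1/z.  The constant term of the triple product
    counts once and not as z^0 + z^-0, so B_0 is 1 also for s = false; the
    factor 2 - s makes up for this. *)
Definition three_term (L : comNzRingType) (s : bool) (t : L) (B : nat -> L) :=
  [/\ B 0%N = 1, t * B 0%N = B 1%N - s%:R * B 0%N,
      t * B 1%N = B 2%N + (2 - s%:R) * B 0%N
    & forall n, t * B n.+2 = B n.+3 + B n.+1].

Lemma theta_coefS (L : comNzRingType) s (r : L) n :
  theta_coef s r n.+1 = theta_coef s r n * theta_base s r ^+ n * r.
Proof. by rewrite /theta_coef binS bin1 exprD exprS; ring. Qed.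

Lemma qfactS (L : comNzRingType) (p : L) m :
  qfact p m.+1 = qfact p m * (1 - p ^+ m.+1).
Proof. exact: big_ord_recr. Qed.

Lemma inv_qfactS (L : comNzRingType) (p : L) (u : nat -> L) :
  (forall m, qfact p m * u m = 1) ->
  forall m, u m = (1 - p ^+ m.+1) * u m.+1.
Proof.
move=> Qu m; have QuS := Qu m.+1.
rewrite qfactS in QuS.
transitivity (u m * (qfact p m * (1 - p ^+ m.+1) * u m.+1)).
  by rewrite QuS mulr1.
transitivity ((qfact p m * u m) * ((1 - p ^+ m.+1) * u m.+1)); first by ring.
by rewrite Qu mul1r.
Qed.

Lemma inv_subS (L : comNzRingType) (p : L) (u : nat -> L) :
  (forall m, qfact p m * u m = 1) ->
  forall m n, inv_sub u m n.+1 = (1 - p ^+ (m - n)) * inv_sub u m n.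
Proof.
move=> Qu m n; rewrite /inv_sub.
case: (ltngtP n m) => [nm|nm|->]; rewrite ?mulr0 //; last first.
  by rewrite subnn subrr mul0r.
by rewrite (inv_qfactS Qu) subnSK.
Qed.

(** Multiplying by one more factor 1 + a^2 - a (z + 1/z) amounts to this
    recurrence.  With x = 1 / (p;p)_(N-n) and y = 1 / (p;p)_(N+n+2+s), all
    entries are polynomial multiples of x y, so that it reduces to a polynomial
    identity. *)
Lemma jtp_coef_rec (L : comNzRingType) s (r : L) (u : nat -> L) N n :
  (forall m, qfact (theta_base s r) m * u m = 1) ->
  let p := theta_base s r in let a := theta_step s r N in
  (1 - p ^+ (2 * N + s).+1) * (1 - p ^+ (2 * N + s).+2)
    * jtp_coef s r u N.+1 n.+1
  = (1 + a ^+ 2) * jtp_coef s r u N n.+1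
    - a * (jtp_coef s r u N n + jtp_coef s r u N n.+2).
Proof.
move=> Qu p a; rewrite /jtp_coef !theta_coefS.
have -> : inv_sub u N.+1 n.+1 = inv_sub u N n by rewrite /inv_sub ltnS subSS.
rewrite !(inv_subS Qu) -/p.
have uS := inv_qfactS Qu; rewrite -/p in uS.
set x := inv_sub u N n.
have [Nn|nN] := ltnP N n; first by rewrite /x /inv_sub leqNgt Nn /=; ring.
have -> : (N.+1 + n.+1 + s = (N + n + s).+2)%N by lia.
have -> : (N + n.+1 + s = (N + n + s).+1)%N by lia.
have -> : (N + n.+2 + s = (N + n + s).+2)%N by lia.
rewrite (uS (N + n + s)%N) (uS (N + n + s).+1).
set y := u _; set g := theta_coef s r n.
rewrite /a /theta_step -/p !exprS.
clearbody x y g; move: nN => /subnK <-; set J := (N - n)%N.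
have -> : (J + n - n.+1 = J.-1)%N by lia.
have -> : (J + n - n = J)%N by lia.
(* J = 0 apart, as the exponent J - 1 is truncated there; the factor 1 - p^J is
   0 in that case. *)
case: J => [|j] /=; case: s @p a Qu uS => p a Qu uS; rewrite /p /theta_base.
all: rewrite ?addn0 ?addn1 mul2n -addnn !(exprS, exprD) ?expr0; ring.
Qed.

(** At n = 0 the neighbour of index -1 is folded back by the symmetry of the
    Laurent polynomials: it contributes once more the entry 1 for s = false,
    and minus the entry 0 for s = true. *)
Lemma jtp_coef_rec0 (L : comNzRingType) s (r : L) (u : nat -> L) N :
  (forall m, qfact (theta_base s r) m * u m = 1) ->
  let p := theta_base s r in let a := theta_step s r N in
  (1 - p ^+ (2 * N + s).+1) * (1 - p ^+ (2 * N + s).+2)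
    * jtp_coef s r u N.+1 0%N
  = (1 + a ^+ 2) * jtp_coef s r u N 0%N
    - a * ((2 - s%:R) * jtp_coef s r u N 1%N - s%:R * jtp_coef s r u N 0%N).
Proof.
move=> Qu p a; rewrite /jtp_coef !theta_coefS.
rewrite !(inv_subS Qu) -/p.
have uS := inv_qfactS Qu; rewrite -/p in uS.
rewrite /inv_sub /= !subn0 !addn0 addSn.
have -> : (N + 1 + s = (N + s).+1)%N by lia.
rewrite /a /theta_step -/p.
case: s @p a Qu uS => p a Qu uS.
  rewrite !addn1 (uS N) (uS N.+1) /p /theta_base /=.
  by rewrite mul2n -addnn !exprS !exprD expr0; ring.
rewrite !addn0 (uS N) /p /theta_base /=.
by rewrite mul2n -addnn !exprS !exprD expr0; ring.
Qed.

(** Summation by parts: the two last terms are the boundary contribution, which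
    vanishes for coefficients of smaller support. *)
Lemma three_term_sum (L : comNzRingType) s (t : L) (B d : nat -> L) M :
  three_term s t B ->
  t * (\sum_(n < M.+2) d n * B n) =
    ((2 - s%:R) * d 1%N - s%:R * d 0%N) * B 0%N
    + \sum_(n < M.+1) (d n + d n.+2) * B n.+1
    + d M.+1 * B M.+2 - d M.+2 * B M.+1.
Proof.
case=> _ t0 t1 tB; elim: M => [|M IH].
  rewrite !big_ord_recr !big_ord0 /=.
  have -> : t * (0 + d 0%N * B 0%N + d 1%N * B 1%N)
      = d 0%N * (t * B 0%N) + d 1%N * (t * B 1%N)
    by ring.
  by rewrite t0 t1; ring.
rewrite big_ord_recr mulrDr IH /= [in RHS]big_ord_recr /=.
have -> : t * (d M.+2 * B M.+2) = d M.+2 * (t * B M.+2) by ring.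
by rewrite tB; ring.
Qed.

(** Any bound M > N may be used, because the coefficients vanish beyond N; this
    freedom lets the induction hypothesis be applied with the range of the
    next step. *)
Theorem finite_jtp (L : comNzRingType) s (r w : L) (u B : nat -> L) N M :
  (forall m, qfact (theta_base s r) m * u m = 1) -> three_term s (w + 2) B ->
  (N < M)%N ->
  \prod_(i < N) ((1 - theta_step s r i) ^+ 2 - theta_step s r i * w)
  = qfact (theta_base s r) (2 * N + s) * \sum_(n < M) jtp_coef s r u N n * B n.
Proof.
move=> Qu B3; elim: N M => [|N IH] M NM.
  case: M NM => // M _.
  rewrite big_ord0 big_ord_recl big1 => [|n _]; last first.
    by rewrite /jtp_coef /inv_sub /= mulr0 !mul0r.
  have u0 : u 0%N = 1 by rewrite -(Qu 0) /qfact big_ord0 mul1r.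
  case: B3 => -> _ _ _.
  rewrite /= /jtp_coef /inv_sub /theta_coef subnn u0 -[LHS](Qu s) expr0 muln0.
  by rewrite bin0n leqnn !expr0 !add0n; ring.
case: M NM => [|[|M]] // NM.
rewrite big_ord_recr /= (IH M.+2) //; last by lia.
set a := theta_step s r N; set S := \sum_(n < M.+2) _.
have -> : qfact (theta_base s r) (2 * N + s) * S * ((1 - a) ^+ 2 - a * w)
   = qfact (theta_base s r) (2 * N + s) * ((1 + a ^+ 2) * S - a * ((w + 2) * S))
  by ring.
rewrite (three_term_sum _ _ B3).
have d0 n : (N < n)%N -> jtp_coef s r u N n = 0.
  by move=> Nn; rewrite /jtp_coef /inv_sub leqNgt Nn /= mulr0 mul0r.
rewrite (d0 M.+1) ?(d0 M.+2) ?mul0r ?addr0 ?subr0; try lia.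
rewrite (_ : 2 * N.+1 + s = (2 * N + s).+2)%N; last by lia.
rewrite !qfactS -2![in RHS]mulrA; congr (_ * _).
rewrite /S big_ord_recl [in RHS]big_ord_recl /=.
set S1 := \sum_(i < _) _; set S2 := \sum_(i < _) _; set S3 := \sum_(i < _) _.
have rec0 := jtp_coef_rec0 N Qu.
suff recS : (1 - theta_base s r ^+ (2 * N + s).+1)
    * (1 - theta_base s r ^+ (2 * N + s).+2) * S3 = (1 + a ^+ 2) * S1 - a * S2.
  rewrite [RHS]mulrA [RHS]mulrDr recS [X in _ = X + _]mulrA rec0 -/a; ring.
rewrite /S3 mulr_sumr.
under eq_bigr => i _ do rewrite mulrA jtp_coef_rec //.
rewrite /S1 /S2 !mulr_sumr -sumrB; apply: eq_bigr => i _ /=; rewrite -/a; ring.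
Qed.

(** * The symmetric Laurent polynomials as polynomials in w *)

(** The coefficient of w^k in z^-n + ... + z^n or in z^n + z^-n, where
    w = z + 1/z - 2.  The predecessor is truncated only for n = k = 0 and
    s = false, where the value 2 is still the right one for z^0 + z^-0. *)
Definition theta_bin (s : bool) (n k : nat) : nat :=
  ('C(n + k + s, 2 * k + s) + 'C((n + k + s).-1, 2 * k + s))%N.

Definition theta_poly (K : comNzRingType) (s : bool) (n : nat) : {poly K} :=
  if n is 0 then 1 else \poly_(k < n.+1) (theta_bin s n k)%:R.

Lemma bin_second_diff m j :
  ('C(m.+2, j.+2) + 'C(m, j.+2) = 2 * 'C(m.+1, j.+2) + 'C(m, j))%N.
Proof. rewrite !binS; lia. Qed.

Lemma theta_bin_rec0 (s : bool) n :
  (theta_bin s n.+2 0 + theta_bin s n 0 = 2 * theta_bin s n.+1 0)%N.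
Proof.
rewrite /theta_bin !addn0.
by case: s => /=; rewrite !(addn0, addn1) ?bin0 ?bin1 //=; lia.
Qed.

(** Comparison of the coefficients of w^(k+1) in
    B_(n+2) + B_n = (w + 2) B_(n+1). *)
Lemma theta_bin_rec (s : bool) n k :
  (theta_bin s n.+2 k.+1 + theta_bin s n k.+1
    = 2 * theta_bin s n.+1 k.+1 + theta_bin s n.+1 k)%N.
Proof.
rewrite /theta_bin.
have -> : (2 * k.+1 + s = (2 * k + s).+2)%N by lia.
have -> : (n.+2 + k.+1 + s = (n + k + s).+3)%N by lia.
have -> : (n.+1 + k.+1 + s = (n + k + s).+2)%N by lia.
have -> : (n + k.+1 + s = (n + k + s).+1)%N by lia.
have -> : (n.+1 + k + s = (n + k + s).+1)%N by lia.
have := bin_second_diff (n + k + s).+1 (2 * k + s).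
have := bin_second_diff (n + k + s) (2 * k + s).
rewrite /=; lia.
Qed.

Lemma coef_theta_poly (K : comNzRingType) (s : bool) n k : (0 < n + s)%N ->
  (theta_poly K s n)`_k = (theta_bin s n k)%:R.
Proof.
case: n => [|n] ns.
  case: s ns => // _; rewrite coef1 /theta_bin; congr _%:R.
  by case: k => // k; rewrite /= !bin_small //; lia.
rewrite coef_poly; case: ifPn => //; rewrite -leqNgt => nk.
by rewrite /theta_bin !bin_small //; lia.
Qed.

Lemma theta_poly_three_term (K : comNzRingType) s :
  three_term s ('X + 2) (theta_poly K s).
Proof.
have rec n : ('X + 2) * theta_poly K s n.+1
    = theta_poly K s n.+2 + \poly_(k < n.+1) (theta_bin s n k)%:R.
  apply/polyP => k.
  rewrite mulrDl mulr_natl coefD coefD coefMn mulrC coefMX coef_poly.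
  have -> : (if (k < n.+1)%N then (theta_bin s n k)%:R else 0)
      = (theta_bin s n k)%:R :> K.
    case: ifPn => //; rewrite -leqNgt => nk.
    by rewrite /theta_bin !bin_small //; lia.
  rewrite !coef_theta_poly // -mulrnA -!natrD mulnC.
  case: k => [|k] /=; first by rewrite add0r theta_bin_rec0.
  by rewrite -natrD addnC theta_bin_rec.
split => //.
- clear rec; apply/polyP => k.
  rewrite mulr1 mulr1 coefB coefD !coef_theta_poly // coefX.
  rewrite -[2]/(2%:R) !coefMn !coef1.
  case: k => [|[|k]] /=.
  + by rewrite /theta_bin; case: s; rewrite ?addn0 /= ?bin1 ?bin0 /= ; ring.
  + by rewrite (_ : theta_bin s 1 1 = 1%N); [ring | case: s].
  + by rewrite /theta_bin !bin_small ?mul0rn; [ring | lia | lia].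
- rewrite rec mulr1; congr (_ + _); apply/polyP => k; rewrite coef_poly coefB.
  clear rec; rewrite -[2]/(2%:R) !coefMn !coef1.
  case: k => [|k] /=; last by rewrite !mul0rn subr0.
  by rewrite /theta_bin; case: s => /=; rewrite ?addn0 ?bin1 ?bin0 /=; ring.
Qed.

(** The two binomial coefficients contribute (n + k + s) and (n - k) times the
    same factorial, and these numbers add up to 2 n + s. *)
Lemma theta_bin_fact (s : bool) n k : (0 < n + s)%N -> (k <= n)%N ->
  ((2 * n + s) * (n + k + s - 1)`!
    = (2 * k + s)`! * (n - k)`! * theta_bin s n k)%N.
Proof.
move=> ns kn; rewrite /theta_bin mulnDr.
have -> : (n + k + s - 1 = (n + k + s).-1)%N by lia.
have h1 : ((2 * k + s)`! * (n - k)`! * 'C(n + k + s, 2 * k + s)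
    = (n + k + s)`!)%N.
  rewrite mulnC -(@bin_fact (n + k + s) (2 * k + s)); last by lia.
  by congr (_ * (_ * _`!))%N; lia.
have h2 : ((2 * k + s)`! * (n - k)`! * 'C((n + k + s).-1, 2 * k + s)
    = (n - k) * (n + k + s).-1`!)%N.
  have [nk|nk] := leqP n k; first by rewrite bin_small ?muln0 1?(_ : n - k = 0)%N //; lia.
  rewrite -(@bin_fact (n + k + s).-1 (2 * k + s)); last by lia.
  rewrite (_ : n - k = (n - k).-1.+1)%N; last by lia.
  rewrite factS (_ : ((n + k + s).-1 - (2 * k + s)) = (n - k).-1)%N;
    last by lia.
  lia.
rewrite h1 h2 -[in RHS](@prednK (n + k + s)) ?factS; last by lia.
rewrite prednK; last by lia.
rewrite -mulnDl; congr (_ * _)%N; lia.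
Qed.

(** * Elementary symmetric functions *)

Definition elem_sym (K : comNzRingType) (N k : nat) (x : nat -> K) : K :=
  \sum_(J : {set 'I_N} | #|J| == k) \prod_(i in J) x i.

Lemma coef_prod_elem_sym (K : comNzRingType) N k (x : nat -> K) :
  (\prod_(i < N) (1 + (x i)%:P * 'X))`_k = elem_sym N k x.
Proof.
under eq_bigr => i _ do rewrite addrC.
rewrite bigA_distr coef_sum /elem_sym [RHS]big_mkcond /=; apply: eq_bigr => J _.
rewrite -big_mkcond /= big_split /= prodr_const -rmorph_prod coefCM coefXn eq_sym.
by case: ifP; rewrite ?mulr1 ?mulr0.
Qed.

Lemma elem_symN (K : comNzRingType) N k (x : nat -> K) :
  elem_sym N k (fun i => - x i) = (-1) ^+ k * elem_sym N k x.
Proof.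
rewrite /elem_sym mulr_sumr; apply: eq_bigr => J /eqP <-.
exact: prodrN.
Qed.

(** * Power series modulo a power of the variable *)

(** Congruence modulo q^(M+1). *)
Definition eqmodX (R : comUnitRingType) (M : nat) (f g : fps R) : Prop :=
  forall i, (i <= M)%N -> f i = g i.

Lemma eqmodX_eq (R : comUnitRingType) (f g : fps R) :
  (forall M, eqmodX M f g) -> f = g.
Proof. by move=> fg; apply/fpsP => n; apply: (fg n). Qed.

Lemma eqmodX_sym (R : comUnitRingType) M (f g : fps R) :
  eqmodX M f g -> eqmodX M g f.
Proof. by move=> fg i /fg. Qed.

Lemma eqmodX_trans (R : comUnitRingType) M (g f h : fps R) :
  eqmodX M f g -> eqmodX M g h -> eqmodX M f h.
Proof. by move=> fg gh i iM; rewrite fg ?gh. Qed.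

Lemma eqmodXM (R : comUnitRingType) M (f f' g g' : fps R) :
  eqmodX M f f' -> eqmodX M g g' -> eqmodX M (f * g) (f' * g').
Proof.
move=> ff gg i iM; apply: eq_bigr => j _.
rewrite ff ?gg //; first exact: leq_trans (leq_subr _ _) iM.
by apply: leq_trans iM; rewrite -ltnS.
Qed.

Lemma eqmodXX (R : comUnitRingType) M (f g : fps R) n :
  eqmodX M f g -> eqmodX M (f ^+ n) (g ^+ n).
Proof. by move=> fg; elim: n => // n IH; rewrite !exprS; apply: eqmodXM. Qed.

Lemma eqmodX_sum (R : comUnitRingType) M (I : Type) (r : seq I) (P : pred I)
    (F G : I -> fps R) :
  (forall i, P i -> eqmodX M (F i) (G i)) ->
  eqmodX M (\sum_(i <- r | P i) F i) (\sum_(i <- r | P i) G i).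
Proof.
move=> FG; apply: (big_ind2 (eqmodX M)) => // f f' g g' ff gg i iM.
by rewrite /= ff ?gg.
Qed.

Lemma eqmodX_inv (R : comUnitRingType) M (f f' u u' : fps R) :
  f * u = 1 -> f' * u' = 1 -> eqmodX M f f' -> eqmodX M u u'.
Proof.
move=> fu fu' ff.
have -> : u = f' * u * u' by rewrite mulrAC fu' mul1r.
have {2}-> : u' = f * u * u' by rewrite fu mul1r.
by do 2?[apply: eqmodXM => //]; apply: eqmodX_sym.
Qed.

Lemma eqmodX_XnM (R : comUnitRingType) M n (f : fps R) :
  (M < n)%N -> eqmodX M (fpsX ^+ n * f) 0.
Proof. by move=> Mn i iM; rewrite fps_coefXnM (leq_ltn_trans iM Mn). Qed.

Lemma fps_coef_sum (R : comUnitRingType) (I : Type) (r : seq I) (P : pred I)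
    (F : I -> fps R) n :
  (\sum_(i <- r | P i) F i) n = \sum_(i <- r | P i) F i n.
Proof. by apply: (big_morph (fun f : fps R => f n)). Qed.

Lemma fps_sum_ord (R : comUnitRingType) (D : set nat) (F : nat -> fps R) N i :
  (forall n, D n -> (N <= n)%N -> F n i = 0) ->
  (forall n, ~ D n -> F n i = 0) ->
  fps_sum D F i = (\sum_(n < N) F n) i.
Proof.
move=> FN FD; rewrite fps_coef_sum (fsbig_ord _ N (fun n => F n i)) /=.
transitivity (\sum_(n \in [set: nat]) F n i).
  by apply: fsbig_widen => // n [_ nD]; apply: FD.
apply/esym/fsbig_widen => // n [_ /= /negP]; rewrite -leqNgt => nN.
by case: (pselect (D n)) => Dn; [apply: FN | apply: FD].
Qed.

(** A factor 1 - h q^(j+1) with j >= M is 1 modulo q^(M+1), so the partial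
    products are constant from the M-th on. *)
Lemma qPochhammer_inf_eqmodX (R : comUnitRingType) (h : fps R) M n :
  (M <= n)%N ->
  eqmodX M (\prod_(j < n) (1 - fpsX * h * fpsX ^+ j))
    (qPochhammer_inf (fpsX * h) fpsX).
Proof.
move=> Mn i iM; have [n0 _ cvg] := qPochhammer_inf_cvg (fpsX * h) i.
rewrite -(cvg (maxn n n0)) /=; last exact: leq_maxr.
have: (n <= maxn n n0)%N by exact: leq_maxl.
elim: (maxn n n0) => [|m IH]; first by rewrite leqn0 => /eqP ->.
rewrite leq_eqVlt => /predU1P[-> //|]; rewrite ltnS => nm.
rewrite (IH nm); set P := \prod_(j < m) _.
have -> : \prod_(j < m.+1) (1 - fpsX * h * fpsX ^+ j)
    = P - fpsX ^+ m.+1 * (h * P).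
  by rewrite big_ord_recr /= -/P exprS; ring.
transitivity (P i - (fpsX ^+ m.+1 * (h * P)) i) => //.
by rewrite fps_coefXnM ifT ?subr0 //; lia.
Qed.

Lemma fps_unitE (R : comUnitRingType) (f : fps R) :
  (f \is a GRing.unit) = (f 0%N \is a GRing.unit).
Proof. by []. Qed.

Lemma fps_natr_coef0 (R : comUnitRingType) n : (n%:R : fps R) 0%N = n%:R.
Proof. by elim: n => // n IH; rewrite -addn1 !natrD -IH. Qed.

Lemma fps_unit_1sub (R : comUnitRingType) n (h : fps R) : (0 < n)%N ->
  (1 - fpsX ^+ n * h) \is a GRing.unit.
Proof.
move=> n0; rewrite fps_unitE.
have -> : (1 - fpsX ^+ n * h) 0%N = 1 - (fpsX ^+ n * h) 0%N by [].
by rewrite fps_coefXnM n0 subr0 unitr1.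
Qed.

(** * MacMahon series as limits of elementary symmetric functions *)

Definition tuple_supp (N k : nat) (m : k.-tuple nat) : {set 'I_N} :=
  [set i : 'I_N | i.+1 \in (m : seq nat)].

Lemma sorted_mem_eq (s t : seq nat) :
  path ltn 0%N s -> path ltn 0%N t -> s =i t -> s = t.
Proof.
move=> /path_sorted ss /path_sorted st; apply: irr_sorted_eq ss st => //.
  exact: ltn_trans.
exact: ltnn.
Qed.

Lemma big_tuple_supp (T : Type) (idx : T) (op : Monoid.com_law idx) N k
    (m : k.-tuple nat) (x : nat -> T) :
  path ltn 0%N m -> all (fun i => i <= N)%N m ->
  \big[op/idx]_(i in tuple_supp N m) x i.+1 = \big[op/idx]_(i < k) x (tnth m i).
Proof.
move=> pm mN; rewrite -(big_tuple _ _ m xpredT x).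
rewrite -big_enum /=.
rewrite -(big_map (fun i : 'I_N => i.+1) xpredT x).
apply: perm_big; apply: uniq_perm.
- rewrite map_inj_uniq ?enum_uniq // => i j [] /val_inj //.
- apply: (sorted_uniq ltn_trans ltnn (path_sorted pm)).
move=> j; apply/mapP/idP => [[i]|jm].
  by rewrite mem_enum inE => im ->.
have := pm; rewrite (path_sortedE ltn_trans) => /andP[/allP/(_ _ jm) /= j0 _].
have jN := allP mN _ jm.
have jN' : (j.-1 < N)%N by rewrite prednK.
by exists (Ordinal jN'); rewrite ?mem_enum ?inE /= prednK.
Qed.

(** An increasing sequence of positive integers is determined by the set of its
    entries.  The ordinal i stands for the integer i + 1. *)
Lemma tuple_supp_bij N k :
  set_bij [set m : k.-tuple nat | path ltn 0%N m && all (fun i => i <= N)%N m]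
    [set J : {set 'I_N} | #|J| == k] (@tuple_supp N k).
Proof.
split.
- move=> m /= /andP[pm mN]; apply/eqP.
  by rewrite -sum1_card (big_tuple_supp addn (fun=> 1%N)) // sum1_card card_ord.
- move=> m m'; rewrite !inE => /andP[pm mN] /andP[pm' mN'] mm'.
  apply/val_inj/sorted_mem_eq => // j.
  case: (posnP j) => [->|j0].
    have zn (t : seq nat) : path ltn 0%N t -> (0%N \in t) = false.
      by rewrite (path_sortedE ltn_trans) => /andP[/allP t0 _]; apply/negP => /t0.
    by rewrite !zn.
  have [jN|Nj] := leqP j N; last first.
    have big (t : seq nat) : all (fun i => i <= N)%N t -> (j \in t) = false.
      by move=> /allP tN; apply/negP => /tN; rewrite leqNgt Nj.
    by rewrite !big.
  have jN' : (j.-1 < N)%N by rewrite prednK.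
  have := congr1 (fun J : {set _} => Ordinal jN' \in J) mm'.
  by rewrite !inE /= prednK.
- move=> J /= /eqP Jk.
  have sz : size [seq (i : 'I_N).+1 | i <- enum J] == k.
    by rewrite size_map -cardE Jk.
  exists (Tuple sz) => /=.
    apply/andP; split; last by apply/allP => _ /mapP[i _ ->].
    rewrite (path_sortedE ltn_trans); apply/andP; split.
      by apply/allP => _ /mapP[i _ ->].
    rewrite (map_comp S val) sorted_map /=.
    rewrite -[enum _](eq_filter (mem_enum _)) -(eq_filter (mem_map val_inj _)).
    rewrite -filter_map (sorted_filter ltn_trans) //.
    by rewrite unlock val_ord_enum iota_ltn_sorted.
  apply/setP => i; rewrite inE /=.
  by rewrite mem_map ?mem_enum // => a b [] /val_inj.
Qed.

(** A tuple with an entry above N contributes only terms of degree above N,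
    since its product is divisible by the corresponding power of q. *)
Lemma fps_sum_elem_sym (R : comUnitRingType) k (e : nat -> nat)
    (y : nat -> fps R) M N :
  (forall j, (j <= e j)%N) -> (M <= N)%N ->
  eqmodX M
    (fps_sum (increasing_pos k) (fun m =>
       \prod_(i < k) (fpsX ^+ e (tnth m i) * y (tnth m i))))
    (elem_sym N k (fun i => fpsX ^+ e i.+1 * y i.+1)).
Proof.
move=> je MN c cM; set x := fun j => fpsX ^+ e j * y j.
rewrite /fps_sum [LHS]/= /elem_sym fps_coef_sum.
rewrite (@bigfs _ _ _ _ _ _ _ (index_enum_uniq _)) => [|J _]; last first.
  by rewrite mem_index_enum.
rewrite (@reindex_fsbig _ _ _ _ _ _ _ _ _ (tuple_supp_bij N k)).
transitivity (\sum_(m \in [set m : k.-tuple nat | path ltn 0%N m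
    && all (fun i => i <= N)%N m]) (\prod_(i < k) x (tnth m i)) c).
  apply/esym/fsbig_widen => [m /= /andP[] //|m /= [pm]].
  rewrite (_ : path _ _ _ = true) //= => /negP /allPn [j jm].
  rewrite -ltnNge => Nj; move/tnthP: jm => [i ij].
  suff : (\prod_(l < k) x (tnth m l)) c = 0 by [].
  have -> : \prod_(l < k) x (tnth m l)
      = fpsX ^+ e j * (y j * \prod_(l < k | l != i) x (tnth m l)).
    by rewrite (bigD1 i) //= -ij mulrA.
  by rewrite fps_coefXnM ifT //; have := je j; lia.
apply: eq_fsbigr => m; rewrite inE => /andP[pm mN].
by rewrite -(@big_tuple_supp _ _ _ N k m x).
Qed.

Definition macmahon_factor (R : comUnitRingType) (s : bool) (i : nat) : fps R :=
  theta_step s fpsX i * ((1 - theta_step s fpsX i) ^+ 2)^-1.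

Lemma theta_stepE (R : comUnitRingType) (s : bool) i :
  theta_step s (fpsX : fps R) i = fpsX ^+ (if s then i.+1 else (2 * i).+1).
Proof. by rewrite /theta_step /theta_base; case: s; rewrite -?exprM -exprSr. Qed.

Lemma theta_step_unit (R : comUnitRingType) (s : bool) i :
  (1 - theta_step s (fpsX : fps R) i) \is a GRing.unit.
Proof.
by rewrite theta_stepE -[fpsX ^+ _]mulr1; apply: fps_unit_1sub; case: s.
Qed.

Lemma macmahonA_elem_sym (R : comUnitRingType) k M N : (M <= N)%N ->
  eqmodX M (macmahonA R k) (elem_sym N k (macmahon_factor R true)).
Proof.
move=> MN; pose y j : fps R := ((1 - fpsX ^+ j) ^+ 2)^-1.
have := @fps_sum_elem_sym R k id y M N (fun=> leqnn _) MN.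
rewrite (_ : fps_sum _ _ = macmahonA R k).
  by congr eqmodX; apply: eq_bigr => J _; apply: eq_bigr => i _;
    rewrite /macmahon_factor theta_stepE.
apply/fpsP => c; apply: eq_fsbigr => m; rewrite inE => Dm.
rewrite /macmahonA_term big_split /= expr_sum prodrV // => i _.
have i0 := increasing_pos_gt0 i Dm; apply/unitrX.
by rewrite -[fpsX ^+ _]mulr1 fps_unit_1sub.
Qed.

Lemma macmahonC_elem_sym (R : comUnitRingType) k M N : (M <= N)%N ->
  eqmodX M (macmahonC R k) (elem_sym N k (macmahon_factor R false)).
Proof.
move=> MN; pose e j := if j is j'.+1 then (2 * j').+1 else 0%N.
pose y j : fps R := ((1 - fpsX ^+ (2 * j - 1)) ^+ 2)^-1.
have je j : (j <= e j)%N by case: j => //= j; lia.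
have := @fps_sum_elem_sym R k e y M N je MN.
rewrite (_ : fps_sum _ _ = macmahonC R k).
  congr eqmodX; apply: eq_bigr => J _; apply: eq_bigr => i _.
  rewrite /macmahon_factor theta_stepE /y /=.
  by rewrite (_ : 2 * i.+1 - 1 = (2 * i).+1)%N; last by lia.
apply/fpsP => c; apply: eq_fsbigr => m; rewrite inE => Dm.
have mpos i := increasing_pos_gt0 i Dm.
have eE i : e (tnth m i) = (2 * tnth m i - 1)%N.
  by have := mpos i; rewrite /e; case: (tnth m i) => // j _; lia.
rewrite /macmahonC_term big_split /= -expr_sum prodrV => [|i _]; last first.
  apply/unitrX; rewrite -[fpsX ^+ _]mulr1 fps_unit_1sub //.
  by have := mpos i; lia.
congr ((fpsX ^+ _ * _) c).
rewrite -[X in (_ - X)%N](card_ord k) -sum1_card -sumnB => [|i _].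
  by apply: eq_bigr => i _; rewrite eE.
by have := mpos i; lia.
Qed.

(** * Passing to the limit in the triple product *)

(** The coefficient of w^k in the finite triple product, after (1 - a)^2 has been
    taken out of each factor (1 - a)^2 - a w. *)
Lemma finite_macmahon (R : comUnitRingType) s k N M (u : nat -> fps R) :
  (forall m, qfact (theta_base s fpsX) m * u m = 1) -> (N < M)%N ->
  (-1) ^+ k * (\prod_(i < N) (1 - theta_step s fpsX i)) ^+ 2
    * elem_sym N k (macmahon_factor R s)
  = qfact (theta_base s fpsX) (2 * N + s)
    * \sum_(n < M) jtp_coef s fpsX u N n * (theta_poly (fps R) s n)`_k.
Proof.
move=> Qu NM; pose r : {poly fps R} := fpsX%:P.
have theta_baseP : theta_base s r = (theta_base s fpsX)%:P.
  by rewrite /theta_base; case: s {Qu}; rewrite ?rmorphXn.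
have qfactP m : qfact (theta_base s r) m = (qfact (theta_base s fpsX) m)%:P.
  rewrite /qfact rmorph_prod /=; apply: eq_bigr => j _.
  by rewrite theta_baseP rmorphB rmorphXn rmorph1.
have stepP i : theta_step s r i = (theta_step s fpsX i)%:P.
  by rewrite /theta_step theta_baseP rmorphM rmorphXn.
have jtpP n : jtp_coef s r (fun m => (u m)%:P) N n = (jtp_coef s fpsX u N n)%:P.
  rewrite /jtp_coef /theta_coef /inv_sub theta_baseP !rmorphM /= !rmorphXn /= rmorphN1.
  by case: ifP => //; rewrite rmorph0.
have Qu' m : qfact (theta_base s r) m * (u m)%:P = 1 by rewrite qfactP -rmorphM Qu.
have := finite_jtp Qu' (theta_poly_three_term (fps R) s) NM.
move=> /(congr1 (fun f : {poly _} => f`_k)).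
rewrite qfactP coefCM coef_sum.
under [X in _ = _ * X -> _]eq_bigr => n _ do rewrite jtpP coefCM.
move=> <-.
have factorE (i : 'I_N) : true ->
    (1 - theta_step s r i) ^+ 2 - theta_step s r i * 'X
  = ((1 - theta_step s fpsX i) ^+ 2)%:P * (1 + (- macmahon_factor R s i)%:P * 'X).
  rewrite stepP.
  have -> : (1 - (theta_step s fpsX i)%:P) ^+ 2
      = ((1 - theta_step s fpsX i) ^+ 2)%:P :> {poly fps R}.
    by rewrite rmorphXn rmorphB rmorph1.
  rewrite mulrDr mulr1 mulrA -rmorphM mulrN /macmahon_factor mulrCA divrr; last first.
    by rewrite unitrX ?theta_step_unit.
  by rewrite mulr1 rmorphN mulNr.
rewrite (eq_bigr _ factorE) big_split /= -rmorph_prod coefCM prodrXl.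
rewrite (coef_prod_elem_sym _ _ (fun i => - macmahon_factor R s i)) elem_symN.
by rewrite [RHS]mulrCA mulrA.
Qed.

Lemma theta_baseE (R : comUnitRingType) (s : bool) :
  theta_base s (fpsX : fps R) = fpsX ^+ (if s then 1 else 2).
Proof. by case: s. Qed.

Lemma qfact_unit (R : comUnitRingType) s m :
  qfact (theta_base s (fpsX : fps R)) m \is a GRing.unit.
Proof.
rewrite unitr_prod // => j _.
rewrite theta_baseE -exprM -[fpsX ^+ _]mulr1 fps_unit_1sub //.
by case: s.
Qed.

Lemma theta_coef_eqmodX0 (R : comUnitRingType) s M n (c : fps R) : (M < n)%N ->
  eqmodX M ((-1) ^+ n * theta_coef s fpsX n * c) 0.
Proof.
move=> Mn; rewrite /theta_coef.
rewrite (_ : _ * c = fpsX ^+ n * ((-1) ^+ n * theta_base s fpsX ^+ 'C(n, 2) * c));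
  last by ring.
exact: eqmodX_XnM.
Qed.

(** For n <= M and N = 2 M both indices N - n and N + n + s are at least M, so
    the reciprocals of the finite products agree with 1 / Q modulo q^(M+1); for
    n > M the power of q in front is already 0 there. *)
Lemma macmahon_theta (R : comUnitRingType) s k (A Q S : fps R) :
  Q \is a GRing.unit ->
  (forall M N, (M <= N)%N ->
     eqmodX M (\prod_(i < N) (1 - theta_step s fpsX i)) A) ->
  (forall M N, (M <= N)%N -> eqmodX M (qfact (theta_base s fpsX) N) Q) ->
  (forall M N, (M <= N)%N -> eqmodX M S (elem_sym N k (macmahon_factor R s))) ->
  (-1) ^+ k * A ^+ 2 * Q * S
  = fps_sum [set: nat] (fun n =>
      (-1) ^+ n * theta_coef s fpsX n * (theta_poly (fps R) s n)`_k).
Proof.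
move=> Qunit limA limQ limS; apply: eqmodX_eq => M.
(* N must exceed every n <= M by at least M. *)
pose N := (2 * M)%N; have MN : (M <= N)%N by rewrite /N; lia.
pose u m := (qfact (theta_base s (fpsX : fps R)) m)^-1.
have Qu m : qfact (theta_base s fpsX) m * u m = 1 by rewrite divrr ?qfact_unit.
have limu m : (M <= m)%N -> eqmodX M (u m) Q^-1.
  by move=> Mm; apply: (eqmodX_inv (Qu m) (divrr Qunit)); apply: limQ.
apply: (@eqmodX_trans _ _ (Q * ((-1) ^+ k
    * (\prod_(i < N) (1 - theta_step s fpsX i)) ^+ 2
    * elem_sym N k (macmahon_factor R s)))).
  rewrite [_ * Q]mulrC -[X in eqmodX _ X _]mulrA; apply: eqmodXM => //.
  apply: eqmodXM; last exact: limS.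
  by apply: eqmodXM => //; apply/eqmodXX/eqmodX_sym/limA.
rewrite (finite_macmahon _ Qu (ltnSn N)).
apply: (@eqmodX_trans _ _ (\sum_(n < N.+1)
    (-1) ^+ n * theta_coef s fpsX n * (theta_poly (fps R) s n)`_k)); last first.
  apply: eqmodX_sym => i iM; apply: fps_sum_ord => [n _ Nn|n []//].
  by rewrite (@theta_coef_eqmodX0 _ _ i) //; lia.
rewrite mulrA mulr_sumr; apply: eqmodX_sum => n _.
set c := _`_k; set Q' := qfact _ _.
have [nM|Mn] := leqP n M; last first.
  apply: eqmodX_trans (eqmodX_sym (theta_coef_eqmodX0 _ _ Mn)).
  have -> : Q * Q' * (jtp_coef s fpsX u N n * c) = (-1) ^+ n * theta_coef s fpsX n
     * (Q * Q' * inv_sub u N n * u (N + n + s)%N * c) by rewrite /jtp_coef; ring.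
  exact: theta_coef_eqmodX0.
have -> : Q * Q' * (jtp_coef s fpsX u N n * c) = (-1) ^+ n * theta_coef s fpsX n
    * c * (Q * Q' * inv_sub u N n * u (N + n + s)%N) by rewrite /jtp_coef; ring.
rewrite -[X in eqmodX _ _ X]mulr1; apply: eqmodXM => //.
have -> : 1 = Q * Q * Q^-1 * Q^-1 by rewrite mulrK // divrr.
apply: eqmodXM; last by apply: limu; lia.
apply: eqmodXM.
  by apply: eqmodXM => //; apply: limQ; lia.
rewrite /inv_sub (leq_trans nM MN); apply: limu; rewrite leq_subRL;
  last exact: leq_trans nM MN.
by rewrite (leq_trans (leq_add nM (leqnn M))) // addnn -mul2n.
Qed.

(** * The infinite products *)

(** The factors of (q;q)_(2N) split by the parity of the exponent, and
    1 - q^(2j) = (1 - q^j) (1 + q^j). *)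
Lemma prod_odd_qfact (R : comNzRingType) (q : R) N :
  \prod_(i < N) (1 - theta_step false q i) * qfact q N
    * \prod_(j < N) (1 + q ^+ j.+1)
  = qfact q (2 * N).
Proof.
elim: N => [|N IH]; first by rewrite /qfact !big_ord0 !mulr1.
rewrite (_ : 2 * N.+1 = (2 * N).+2)%N; last by lia.
rewrite !qfactS -IH !big_ord_recr /= /theta_step /theta_base.
by rewrite -exprM !exprSr mul2n -addnn exprD; ring.
Qed.

Lemma qfact_sqr (R : comNzRingType) (q : R) N :
  qfact (q ^+ 2) N = qfact q N * \prod_(j < N) (1 + q ^+ j.+1).
Proof.
rewrite /qfact -big_split /=; apply: eq_bigr => j _.
by rewrite -exprM mulnC exprM; ring.
Qed.

Lemma qfact_qPochhammer (R : comUnitRingType) M N : (M <= N)%N ->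
  eqmodX M (qfact fpsX N) (qPochhammer_inf (fpsX : fps R) fpsX).
Proof.
move=> MN; have := @qPochhammer_inf_eqmodX R 1 M N MN; rewrite mulr1.
by under eq_bigr do rewrite -exprS.
Qed.

Lemma prod1D_qPochhammer (R : comUnitRingType) M N : (M <= N)%N ->
  eqmodX M (\prod_(j < N) (1 + fpsX ^+ j.+1))
    (qPochhammer_inf (- fpsX : fps R) fpsX).
Proof.
move=> MN; have := @qPochhammer_inf_eqmodX R (-1) M N MN; rewrite mulrN1.
by under eq_bigr do rewrite mulNr opprK -exprS.
Qed.

Lemma eqmodX_unit (R : comUnitRingType) (f : fps R) g : g \is a GRing.unit ->
  eqmodX 0 g f -> f \is a GRing.unit.
Proof. by rewrite !fps_unitE => gu /(_ 0%N (leqnn _)) <-. Qed.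

Lemma qPochhammerX_unit (R : comUnitRingType) :
  qPochhammer_inf (fpsX : fps R) fpsX \is a GRing.unit.
Proof.
apply: (eqmodX_unit _ (qfact_qPochhammer _ (leqnn 0))).
exact: (qfact_unit R true).
Qed.

Lemma qPochhammerNX_unit (R : comUnitRingType) :
  qPochhammer_inf (- fpsX : fps R) fpsX \is a GRing.unit.
Proof.
apply: (eqmodX_unit _ (prod1D_qPochhammer _ (leqnn 0))).
by rewrite big_ord0 unitr1.
Qed.

(** Euler's identity, obtained by letting N grow in [prod_odd_qfact] and
    cancelling (q;q). *)
Lemma prod_odd_qPochhammer (R : comUnitRingType) M N : (M <= N)%N ->
  eqmodX M (\prod_(i < N) (1 - theta_step false fpsX i))
    (qPochhammer_inf (- fpsX : fps R) fpsX)^-1.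
Proof.
move=> MN; set F := qPochhammer_inf _ _.
pose E : fps R := qPochhammer_inf fpsX fpsX.
have Eu : E \is a GRing.unit := qPochhammerX_unit R.
have Fu : F \is a GRing.unit := qPochhammerNX_unit R.
set O := \prod_(i < N) _.
have -> : O = O * E * F * (E * F)^-1 by
  rewrite -[O * E * F]mulrA mulrK // unitrM Eu.
have -> : F^-1 = E * (E * F)^-1 by rewrite invrM // mulrCA divrr ?mulr1.
apply: eqmodXM => //.
apply: (@eqmodX_trans _ _ (O * qfact fpsX N * \prod_(j < N) (1 + fpsX ^+ j.+1))).
  apply: eqmodXM; last exact/eqmodX_sym/prod1D_qPochhammer.
  by apply: eqmodXM => //; apply/eqmodX_sym/qfact_qPochhammer.
by rewrite prod_odd_qfact; apply: qfact_qPochhammer; lia.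
Qed.

(** * The closed formulas *)

Lemma fps_sum_widen (R : comUnitRingType) (I : choiceType) (D D' : set I)
    (F G : I -> fps R) :
  D `<=` D' -> (forall i, D i -> F i = G i) ->
  (forall i, ~ D i -> G i = 0) -> fps_sum D F = fps_sum D' G.
Proof.
move=> DD FG G0; apply/fpsP => n.
transitivity (\sum_(i \in D) G i n).
  by apply: eq_fsbigr => i; rewrite inE => /FG ->.
by apply: fsbig_widen => // i [_ /G0 Gi]; rewrite /preimage /= Gi.
Qed.

Lemma fps_sumMnr (R : idomainType) (I : choiceType) (D : set I)
    (F : I -> fps R) c :
  fps_sum D (fun i => c%:R * F i) = c%:R * fps_sum D F.
Proof.
have coefMn (f : fps R) i : (c%:R * f) i = c%:R * f i.
  rewrite !mulr_natl; elim: c => // c IH; rewrite !mulrS -IH //.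
apply/fpsP => i; rewrite coefMn [RHS]mulr_fsumr.
by apply: eq_fsbigr => j _; rewrite coefMn.
Qed.

Lemma fact_unit n : (n`!%:R : fps rat) \is a GRing.unit.
Proof.
rewrite fps_unitE fps_natr_coef0 unitfE Num.Theory.pnatr_eq0.
by rewrite -lt0n fact_gt0.
Qed.

Lemma theta_term_fact (s : bool) n k : (0 < n + s)%N ->
  (2 * n + s)%:R * ((n + k + s - 1)`!%:R * inv_fact_sub (fps rat) n k)
  = (2 * k + s)`!%:R * (theta_poly (fps rat) s n)`_k.
Proof.
move=> ns; rewrite coef_theta_poly // /inv_fact_sub.
have [nk|kn] := ltnP n k.
  by rewrite /theta_bin !bin_small ?mulr0 //; lia.
rewrite mulrA -natrM theta_bin_fact // natrM mulrAC natrM mulrK //; exact: fact_unit.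
Qed.

Theorem corollary2 :
  let q : fps rat := fpsX in
  (forall k : nat,
     macmahonA rat k =
       (-1) ^+ k / ((2 * k + 1)`!%:R * qPochhammer_inf q q ^+ 3)
       * fps_sum [set: nat] (fun n : nat =>
           (-1) ^+ n * (2 * n + 1)%:R
           * ((n + k)`!%:R * inv_fact_sub (fps rat) n k)
           * q ^+ (n * (n + 1))./2))
  /\
  (forall k : nat, (1 <= k)%N ->
     macmahonC rat k =
       (-1) ^+ k * qPochhammer_inf (- q) q
         / ((2 * k)`!%:R * qPochhammer_inf q q)
       * fps_sum [set n : nat | (1 <= n)%N] (fun n : nat =>
           (-1) ^+ n * (2 * n)%:R
           * ((n + k - 1)`!%:R * inv_fact_sub (fps rat) n k)
           * q ^+ (n ^ 2))).
Proof.
move=> q; set E := qPochhammer_inf q q; set F := qPochhammer_inf (- q) q.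
have Eu : E \is a GRing.unit := qPochhammerX_unit rat.
have Fu : F \is a GRing.unit := qPochhammerNX_unit rat.
split=> k.
  have limE := @qfact_qPochhammer rat.
  have limA M N : (M <= N)%N ->
      eqmodX M (\prod_(i < N) (1 - theta_step true q i)) E.
    move=> MN; have := limE M N MN; rewrite /qfact.
    by under eq_bigr do rewrite exprSr.
  have := @macmahon_theta rat true k E E _ Eu limA limE (@macmahonA_elem_sym rat k).
  set T := fps_sum _ _ => AT.
  have -> : fps_sum [set: nat] (fun n : nat => (-1) ^+ n * (2 * n + 1)%:R
      * ((n + k)`!%:R * inv_fact_sub (fps rat) n k) * q ^+ (n * (n + 1))./2)
      = (2 * k + 1)`!%:R * T.
    rewrite -fps_sumMnr; congr fps_sum; apply: funext => n.
    have n0 : (0 < n + true)%N by rewrite addn1.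
    have tE := theta_term_fact k n0; rewrite addnK in tE.
    have -> : theta_coef true q n = q ^+ (n * (n + 1))./2.
      rewrite /theta_coef /theta_base -exprD addn1 mulnC -[n]/(n.+1.-1) -bin2 binS bin1.
      done.
    rewrite -[X in X * _ = _]mulrA tE; ring.
  rewrite -AT; set fk := (_`!)%:R.
  have fku : fk \is a GRing.unit := fact_unit _.
  have Eku : fk * E ^+ 3 \is a GRing.unit by rewrite unitrM fku unitrX.
  have sq : (-1) ^+ k * (-1) ^+ k = 1 :> fps rat.
  by rewrite -exprMn mulrNN mulr1 expr1n.
  rewrite (_ : _ * (fk * _) = ((-1) ^+ k * (-1) ^+ k) *
     ((fk * E ^+ 3) / (fk * E ^+ 3)) * macmahonA rat k); last by ring.
  by rewrite sq divrr // !mul1r.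
move=> k0.
have limO := @prod_odd_qPochhammer rat.
have limEF M N : (M <= N)%N -> eqmodX M (qfact (theta_base false q) N) (E * F).
  move=> MN; rewrite /theta_base qfact_sqr.
  by apply: eqmodXM; [apply: qfact_qPochhammer | apply: prod1D_qPochhammer].
have EFu : E * F \is a GRing.unit by rewrite unitrM Eu.
have := @macmahon_theta rat false k F^-1 (E * F) _ EFu limO limEF
  (@macmahonC_elem_sym rat k).
set T := fps_sum _ _ => AT.
have -> : fps_sum [set n : nat | (1 <= n)%N] (fun n : nat => (-1) ^+ n * (2 * n)%:R
    * ((n + k - 1)`!%:R * inv_fact_sub (fps rat) n k) * q ^+ (n ^ 2))
    = (2 * k)`!%:R * T.
  rewrite -fps_sumMnr; apply: fps_sum_widen => // n; last first.
    case: n => [_|n []//]; rewrite -[theta_poly _ _ _]/1 coef1 eqn0Ngt k0.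
    by rewrite !mulr0.
  move=> n0.
  have := @theta_term_fact false n k; rewrite !addn0 => /(_ n0) tE.
  have -> : theta_coef false q n = q ^+ (n ^ 2).
    rewrite /theta_coef /theta_base -exprM -exprD; congr (q ^+ _).
    rewrite -mul_bin_diag bin1 -[X in (_ + X)%N = _]muln1 -mulnDr addn1 prednK //.
  rewrite -[X in X * _ = _]mulrA tE; ring.
rewrite -AT; set fk := (_`!)%:R.
have fku : fk \is a GRing.unit := fact_unit _.
have fEu : fk * E \is a GRing.unit by rewrite unitrM fku.
have sq : (-1) ^+ k * (-1) ^+ k = 1 :> fps rat.
  by rewrite -exprMn mulrNN mulr1 expr1n.
rewrite (_ : _ * (fk * _) = ((-1) ^+ k * (-1) ^+ k) * ((fk * E) / (fk * E))
   * (F / F) * (F / F) * macmahonC rat k); last by ring.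
by rewrite sq !divrr // !mul1r.
Qed.
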